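(* Let $\mathcal{E}$ be a Euclidean space. A smooth embedded submanifold of $\mathcal{E}$ with boundary is Clarke regular (at each of its points), hence has no apocalypses (none of its points is apocalyptic).
   Context: Tangent cone to $\mathcal{X}\subseteq\mathcal{E}$: $\mathrm{T}_x\mathcal{X}=\{v=\lim_{k\to\infty}(z_k-x)/\tau_k : z_k\in\mathcal{X},\ \tau_k>0,\ \tau_k\to 0,\text{ the limit exists}\}$. For subsets $C_k\subseteq\mathcal{E}$: $\liminf_k C_k=\{v:\limsup_{k\to\infty}\operatorname{dist}(v,C_k)=0\}$. A locally closed set $\mathcal{X}$ is Clarke regular at $x\in\mathcal{X}$ if $\mathrm{T}_x\mathcal{X}\subseteq\liminf_k\mathrm{T}_{x_k}\mathcal{X}$ for all sequences $(x_k)_{k\geq1}$ in $\mathcal{X}$ converging to $x$. $\operatorname{Proj}_K(v)$ is any closest point to $v$ in the closed cone $K$. For $f$ continuously differentiable on a neighborhood of $\mathcal{X}$, a point $x\in\mathcal{X}$ is stationary if $\mathrm{D}f(x)[v]\geq0$ for all $v\in\mathrm{T}_x\mathcal{X}$, and $\epsilon$-stationary if $\|\operatorname{Proj}_{\mathrm{T}_x\mathcal{X}}(-\nabla f(x))\|\leq\epsilon$. The point $x$ is apocalyptic if there exist a sequence $(x_k)\subseteq\mathcal{X}$ converging to $x$, a continuously differentiable $f$, and $\epsilon_k>0$ with $\epsilon_k\to0$, such that each $x_k$ is $\epsilon_k$-stationary for $f$ on $\mathcal{X}$ but $x$ is not stationary (such a triplet $(x,(x_k),f)$ is called an apocalypse).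 *)

(* Defs.v *)
From HB Require Import structures.
From mathcomp Require Import all_boot all_order all_algebra.
From mathcomp Require Import sesquilinear.
From mathcomp Require Import all_classical all_reals all_analysis.

Set Implicit Arguments.
Unset Strict Implicit.
Unset Printing Implicit Defensive.

Import Order.TTheory GRing.Theory Num.Theory.
Import numFieldNormedType.Exports.

Local Open Scope classical_set_scope.
Local Open Scope ring_scope.

(* The norm of E (hence its topology and its differential calculus) is the one
   induced by the inner product, and E is spanned by finitely many vectors. *)
Definition euclidean (R : realType) (E : normedModType R)
    (ip : {dot E for idfun}) : Prop :=
  (forall v : E, `|v| ^+ 2 = ip v v) /\
  (exists (n : nat) (b : 'I_n -> E),
     forall v : E, exists c : 'I_n -> R, v = \sum_(i < n) c i *: b i).

(* Meant for finite-dimensional V, where continuity of x |-> 'd f x in operator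
   norm is the same as continuity of x |-> 'd f x v for each v. *)
Fixpoint Ck_on (R : realType) (V W : normedModType R) (m : nat) (O : set V)
    (f : V -> W) {struct m} : Prop :=
  match m with
  | 0%N => forall x, O x -> {for x, continuous f}
  | m'.+1 => (forall x, O x -> differentiable f x) /\
             (forall v : V, Ck_on m' O (fun x => 'd f x v))
  end.

Definition smooth_on (R : realType) (V W : normedModType R) (O : set V)
    (f : V -> W) : Prop := forall m, Ck_on m O f.

(* Last coordinate nonnegative; for k = 0 the condition is void and this is the
   one-point space 'rV_0. *)
Definition halfspace (R : realType) (k : nat) : set 'rV[R]_k :=
  [set u | forall i : 'I_k, i.+1 = k -> 0 <= u ord0 i].

(* psi parametrizes the open subset U `&` X of X by the relatively open subset
   O `&` halfspace of the half-space, with inverse (a chart of X) phi; smoothness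
   of psi up to the boundary means having a smooth extension to the open set O.
   The inclusion of X, read in this chart, is psi itself: it is required to be an
   immersion and a homeomorphism onto its image for the subspace topology. *)
Definition boundary_chart (R : realType) (E : normedModType R) (X : set E)
    (k : nat) (U : set E) (O : set 'rV[R]_k)
    (psi : 'rV[R]_k -> E) (phi : E -> 'rV[R]_k) : Prop :=
  [/\ open U /\ open O,
      smooth_on O psi,
      (forall u, O u -> halfspace u -> injective ('d psi u : 'rV[R]_k -> E)),
      psi @` (O `&` @halfspace R k) = U `&` X &
      (forall u, O u -> halfspace u -> phi (psi u) = u) /\
      {within U `&` X, continuous phi}].

(* Compatibility of the charts is automatic: transition maps phi2 \o psi1 are
   smooth because psi1 and psi2 are smooth immersions into E. *)
Definition embedded_submanifold_with_boundary (R : realType)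
    (E : normedModType R) (X : set E) : Prop :=
  exists k : nat, forall x, X x ->
    exists (U : set E) (O : set 'rV[R]_k) (psi : 'rV[R]_k -> E)
           (phi : E -> 'rV[R]_k),
      U x /\ boundary_chart X U O psi phi.

Definition tangent_cone (R : realType) (E : normedModType R) (X : set E)
    (x : E) : set E :=
  [set v | exists (z : nat -> E) (tau : nat -> R),
     [/\ forall k, X (z k), forall k, 0 < tau k,
         tau k @[k --> \oo] --> (0 : R) &
         (tau k)^-1 *: (z k - x) @[k --> \oo] --> v]].

(* edist_inf C v is the distance from v to C, +oo when C is empty. *)
Definition liminf_sets (R : realType) (E : normedModType R)
    (C : nat -> set E) : set E :=
  [set v | limn_esup (fun k => edist_inf (C k) v) = 0%E].

Definition locally_closed (T : topologicalType) (X : set T) : Prop :=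
  exists (U F : set T), [/\ open U, closed F & X = U `&` F].

Definition clarke_regular (R : realType) (E : normedModType R) (X : set E)
    (x : E) : Prop :=
  [/\ locally_closed X, X x &
      forall s : nat -> E, (forall k, X (s k)) -> s k @[k --> \oo] --> x ->
        tangent_cone X x `<=` liminf_sets (fun k => tangent_cone X (s k))].

Definition is_proj (R : realType) (E : normedModType R) (K : set E)
    (v p : E) : Prop :=
  K p /\ forall q, K q -> `|v - p| <= `|v - q|.

Definition gradient (R : realType) (E : normedModType R)
    (ip : {dot E for idfun}) (f : E -> R) (x : E) : E :=
  xget 0 [set g | forall v : E, 'd f x v = ip g v].

Definition stationary (R : realType) (E : normedModType R) (X : set E)
    (f : E -> R) (x : E) : Prop :=
  forall v, tangent_cone X x v -> 0 <= 'd f x v.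

(* All closest points p to w in a closed cone have the same norm, since
   |p|^2 = |w|^2 - |w - p|^2. *)
Definition eps_stationary (R : realType) (E : normedModType R)
    (ip : {dot E for idfun}) (X : set E) (f : E -> R) (eps : R) (x : E) : Prop :=
  exists p, is_proj (tangent_cone X x) (- gradient ip f x) p /\ `|p| <= eps.

(* f is only used on the neighborhood O of X; its values elsewhere are
   irrelevant. *)
Definition apocalyptic (R : realType) (E : normedModType R)
    (ip : {dot E for idfun}) (X : set E) (x : E) : Prop :=
  X x /\
  exists (s : nat -> E) (f : E -> R) (O : set E) (eps : nat -> R),
    [/\ (forall k, X (s k)) /\ s k @[k --> \oo] --> x,
        [/\ open O, X `<=` O & Ck_on 1 O f],
        (forall k, 0 < eps k) /\ eps k @[k --> \oo] --> (0 : R),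
        forall k, eps_stationary ip X f (eps k) (s k) &
        ~ stationary X f x].

(* Main.v *)
(* In a boundary chart psi, the tangent cone of X at psi u is the image under
   'd psi u of the tangent cone of the half-space at u: an injective linear map
   on a finite-dimensional space is bounded below, so difference quotients in X
   lift to difference quotients in the half-space.  A direction w tangent to the
   half-space at u stays tangent at all nearby points u' of the half-space (the
   cone can only grow when leaving the boundary), and 'd psi u' w tends to
   'd psi u w; this is Clarke regularity.  Local closedness follows from the
   compactness of the psi-images of small closed half-balls.

   At an eps-stationary point s, every tangent vector q satisfies
   - 2 'd f s q <= eps (1 + |q|^2).  By Clarke regularity a tangent vector v at x
   is a limit of tangent vectors at the s n, so 'd f x v >= 0 in the limit. *)

Require Import Defs.
From mathcomp Require Import all_boot all_order all_algebra.
From mathcomp Require Import sesquilinear.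
From mathcomp Require Import all_classical all_reals all_analysis.
From mathcomp Require Import ring lra.

Set Implicit Arguments.
Unset Strict Implicit.
Unset Printing Implicit Defensive.

Import Order.TTheory GRing.Theory Num.Theory.
Import numFieldNormedType.Exports.

Local Open Scope classical_set_scope.
Local Open Scope ring_scope.

(** * Inner products, dual families and coordinates *)

Lemma dotC (R : realType) (E : lmodType R) (ip : {dot E for idfun}) u v :
  ip u v = ip v u.
Proof. by rewrite hermC expr0 mul1r. Qed.

Lemma dotDr (R : realType) (E : lmodType R) (ip : {dot E for idfun}) u v w :
  ip u (v + w) = ip u v + ip u w.
Proof. exact: linearDr. Qed.

Lemma dotNr (R : realType) (E : lmodType R) (ip : {dot E for idfun}) u v :
  ip u (- v) = - ip u v.
Proof. exact: linearNr. Qed.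

Lemma dotZr (R : realType) (E : lmodType R) (ip : {dot E for idfun}) a u v :
  ip u (a *: v) = a * ip u v.
Proof. exact: linearZr_LR. Qed.

Lemma dotDD (R : realType) (E : lmodType R) (ip : {dot E for idfun}) u v :
  ip (u + v) (u + v) = ip u u + ip u v *+ 2 + ip v v.
Proof. by rewrite dotDr ![ip (u + v) _]dotC !dotDr (dotC ip v u); ring. Qed.

Lemma dot_sumZr (R : realType) (E : lmodType R) (ip : {dot E for idfun})
    u n (c : 'I_n -> R) (b : 'I_n -> E) :
  ip u (\sum_(i < n) c i *: b i) = \sum_(i < n) c i * ip u (b i).
Proof. by rewrite linear_sumr; apply: eq_bigr => i _; rewrite linearZr_LR. Qed.

Lemma dot_sumZl (R : realType) (E : lmodType R) (ip : {dot E for idfun})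
    u n (c : 'I_n -> R) (b : 'I_n -> E) :
  ip (\sum_(i < n) c i *: b i) u = \sum_(i < n) c i * ip (b i) u.
Proof. by rewrite dotC dot_sumZr; apply: eq_bigr => i _; rewrite dotC. Qed.

Lemma dot_eq0 (R : realType) (E : lmodType R) (ip : {dot E for idfun}) u :
  ip u u = 0 -> u = 0.
Proof.
move=> u0; apply/eqP; apply: contraT => /(neq0_dnorm_gt0 (s := ip)).
by rewrite u0 ltxx.
Qed.

Definition free_family (R : realType) (E : lmodType R) n (b : 'I_n -> E) :=
  forall c : 'I_n -> R, \sum_(i < n) c i *: b i = 0 -> forall i, c i = 0.

(* The dual family is the image of b under the inverse of its Gram matrix. *)
Lemma dual_family (R : realType) (E : lmodType R) (ip : {dot E for idfun})
    n (b : 'I_n -> E) : free_family b ->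
  exists d : 'I_n -> E,
    forall (c : 'I_n -> R) i, ip (d i) (\sum_(j < n) c j *: b j) = c i.
Proof.
move=> fb; pose G : 'M[R]_n := \matrix_(i, j) ip (b i) (b j).
(* A row vector killed by the Gram matrix gives a combination of the [b i] orthogonal to every
   [b j], hence to itself, hence zero. *)
have Gu : G \in unitmx.
  rewrite -row_free_unit; apply: inj_row_free => u uG0.
  have /fb u0 : \sum_(i < n) u 0 i *: b i = 0.
    apply: (dot_eq0 (ip := ip)); rewrite dot_sumZr big1// => j _.
    rewrite dot_sumZl; have /rowP/(_ j) := uG0; rewrite !mxE.
    under eq_bigr do rewrite mxE.
    by move=> ->; rewrite mulr0.
  by apply/rowP => i; rewrite u0 mxE.
exists (fun i => \sum_(j < n) invmx G i j *: b j) => c i.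
have dE j : ip (\sum_(j < n) invmx G i j *: b j) (b j) = (i == j)%:R.
  rewrite dot_sumZl; have /matrixP/(_ i j) := mulVmx Gu; rewrite !mxE => <-.
  by apply: eq_bigr => l _; rewrite !mxE.
rewrite dot_sumZr (bigD1 i)//= dE eqxx mulr1 big1 ?addr0// => j ji.
by rewrite dE eq_sym (negPf ji) mulr0.
Qed.

(** As long as the family satisfies a nontrivial relation, a vector with a nonzero coefficient in it
    can be discarded. *)
Lemma free_spanning_family (R : realType) (E : lmodType R) n (b : 'I_n -> E) :
  (forall v, exists c : 'I_n -> R, v = \sum_(i < n) c i *: b i) ->
  exists m (b' : 'I_m -> E), free_family b' /\
    (forall v, exists c : 'I_m -> R, v = \sum_(i < m) c i *: b' i).
Proof.
elim: n b => [|n IH] b sb; first by exists 0%N, b; split=> // c _ [].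
have [fb|nfb] := pselect (free_family b); first by exists n.+1, b.
have [a [a0 [i ai]]] : exists a : 'I_n.+1 -> R,
    \sum_(i < n.+1) a i *: b i = 0 /\ exists i, a i != 0.
  apply: contrapT => h; apply: nfb => c c0 i.
  apply: contrapT => /eqP ci; apply: h; exists c; split=> //; by exists i.
apply: (IH (fun j => b (lift i j))) => v; have [c ->] := sb v.
(* Subtracting [c i / a i] times the relation [a] cancels the coefficient of [b i]. *)
exists (fun j => c (lift i j) - c i / a i * a (lift i j)).
have -> : \sum_(i < n.+1) c i *: b i =
    \sum_(j < n.+1) (c j - c i / a i * a j) *: b j.
  under [RHS]eq_bigr do rewrite scalerBl -scalerA.
  by rewrite sumrB -scaler_sumr a0 scaler0 subr0.
rewrite (bigD1_ord i)//= divfK// subrr scale0r add0r.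
by apply: eq_bigr.
Qed.

Lemma euclidean_coordinates (R : realType) (E : normedModType R)
    (ip : {dot E for idfun}) : euclidean ip ->
  exists n (b d : 'I_n -> E), forall v, v = \sum_(i < n) ip (d i) v *: b i.
Proof.
move=> [_ [n0 [b0 /free_spanning_family[n [b [fb sb]]]]]].
have [d db] := dual_family ip fb; exists n, b, d => v.
by have [c ->] := sb v; apply: eq_bigr => i _; rewrite db.
Qed.

Lemma riesz (R : realType) (E : normedModType R) (ip : {dot E for idfun})
    (l : {linear E -> R^o}) : euclidean ip ->
  exists g, forall v, l v = ip g v.
Proof.
move=> /euclidean_coordinates[n [b [d bd]]].
exists (\sum_(i < n) l (b i) *: d i) => v.
rewrite dot_sumZl {1}(bd v) linear_sum; apply: eq_bigr => i _.
by rewrite linearZ mulrC.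
Qed.

(** The images of the standard basis vectors are free, and their dual family gives a left inverse of
    [A] made of inner products. Finite dimension of [E] does not enter. *)
Lemma injective_linear_dual (R : realType) (E : lmodType R)
    (ip : {dot E for idfun}) k (A : {linear 'rV[R]_k -> E}) :
  injective A -> exists d : 'I_k -> E, forall w i, ip (d i) (A w) = w ord0 i.
Proof.
move=> Ai; pose b i := A (delta_mx 0 i).
have Ab w : A w = \sum_(i < k) w 0 i *: b i.
  rewrite {1}[w]row_sum_delta linear_sum.
  by apply: eq_bigr => i _; rewrite linearZ.
have fb : free_family b.
  move=> c c0 i; have : A (\row_j c j) = A 0.
    by rewrite linear0 Ab -[RHS]c0; apply: eq_bigr => j _; rewrite mxE.
  by move=> /Ai/rowP/(_ i); rewrite !mxE.
have [d db] := dual_family ip fb; exists d => w i.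
by rewrite Ab db.
Qed.

(** * Continuity of the inner product and lower bounds for injective linear maps *)

(** Reduces the continuity of [ip u] to that of the norm. *)
Lemma polarization (R : realType) (E : normedModType R)
    (ip : {dot E for idfun}) : euclidean ip ->
  forall u v, ip u v = (`|u + v| ^+ 2 - `|u - v| ^+ 2) / 4.
Proof.
move=> [nE _] u v; have dotNl x : ip (- v) x = - ip v x.
  by rewrite dotC dotNr dotC.
by rewrite !nE !dotDD dotNr dotNl dotNr; field.
Qed.

Lemma cvg_dot (R : realType) (E : normedModType R) (ip : {dot E for idfun})
    (T : Type) (F : set_system T) (f : T -> E) (u v : E) :
  Filter F -> euclidean ip ->
  f x @[x --> F] --> v -> ip u (f x) @[x --> F] --> ip u v.
Proof.
move=> FF hE fv; rewrite (polarization hE).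
under eq_fun do rewrite (polarization hE).
apply: cvgMl; apply: cvgB; apply: cvgM; apply: cvg_norm.
- by apply: cvgD => //; exact: cvg_cst.
- by apply: cvgD => //; exact: cvg_cst.
- by apply: cvgB => //; exact: cvg_cst.
- by apply: cvgB => //; exact: cvg_cst.
Qed.

Lemma dot_norm_le (R : realType) (E : normedModType R) (ip : {dot E for idfun})
    u v : euclidean ip -> `|ip u v| <= `|u| * `|v|.
Proof.
move=> [nE _]; have [->|v0] := eqVneq v 0.
  by rewrite [ip u 0](linear0r ip u) !normr0 mulr0.
have nv : 0 < `|v| by rewrite normr_gt0.
rewrite -(@ler_pXn2r _ 2) ?nnegrE ?mulr_ge0// exprMn real_normK ?num_real//.
(* This vector is [|v|^2] times the component of [u] orthogonal to [v]; the scaling avoids a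
   division. *)
have := sqr_ge0 `|(`|v| ^+ 2) *: u - (ip u v) *: v|.
have Nl x y : ip (- x) y = - ip x y by rewrite dotC dotNr dotC.
have Zl a x y : ip (a *: x) y = a * ip x y by rewrite dotC dotZr dotC.
rewrite nE dotDD !dotNr !Nl !dotZr !Zl -!nE.
move: (`|v| ^+ 2) (exprn_gt0 2 nv) => s s0 h.
rewrite -(ler_pM2l s0) -subr_ge0; apply: le_trans h _.
by rewrite le_eqVlt; apply/orP; left; apply/eqP; ring.
Qed.

Lemma injective_linear_below (R : realType) (E : normedModType R)
    (ip : {dot E for idfun}) k (A : {linear 'rV[R]_k -> E}) :
  euclidean ip -> injective A -> exists2 C, 0 < C & forall w, `|w| <= C * `|A w|.
Proof.
move=> hE /(injective_linear_dual ip)[d dA].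
pose S := \sum_(i < k) `|d i|; have S0 : 0 <= S by exact: sumr_ge0.
(* Each coordinate of [w] is the inner product of some [d i] with [A w], and the norm of [w] is the
   largest absolute value of a coordinate. The summand 1 keeps the constant positive when
   [k = 0]. *)
exists (1 + S) => [|w]; first by rewrite ltr_wpDr.
rewrite [X in X <= _]/Num.norm/= mx_normrE; apply/bigmax_leP; split => [|[i j] _].
  by rewrite mulr_ge0// addr_ge0.
rewrite /= (ord1 i) -dA (le_trans (dot_norm_le _ _ hE))// ler_wpM2r//.
rewrite /S (bigD1 j)//= addrCA lerDl addr_ge0//.
exact: sumr_ge0.
Qed.

Lemma cvg_rV (R : realType) k (T : Type) (F : set_system T)
    (h : T -> 'rV[R]_k) (w : 'rV[R]_k) : Filter F ->
  (forall i, h x ord0 i @[x --> F] --> w ord0 i) -> h x @[x --> F] --> w.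
Proof.
move=> FF hw; rewrite [w]row_sum_delta.
under eq_fun => x do rewrite (row_sum_delta (h x)).
apply: cvg_big => [|i _]; first exact: add_continuous.
by apply: cvgZr_tmp; exact: hw.
Qed.

(** * Difference quotients through a differentiable map *)

Lemma diff_remainder (R : realType) (V W : normedModType R) (f : V -> W) u :
  differentiable f u -> forall e, 0 < e ->
  \forall y \near u, `|f y - f u - 'd f u (y - u)| <= e * `|y - u|.
Proof.
move=> df e e0; have /eqaddoP/(_ e e0) := diff_locally df.
rewrite (near_shift 0 u); apply: filterS => y /=; rewrite subr0 addrK.
by rewrite [in X in X -> _]opprD addrA.
Qed.

Lemma quotient_remainder (R : realType) (V W : normedModType R) (f : V -> W)
    u (y : nat -> V) (tau : nat -> R) :
  differentiable f u -> y n @[n --> \oo] --> u -> (forall n, 0 < tau n) ->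
  forall e, 0 < e -> \forall n \near \oo,
    `|(tau n)^-1 *: (f (y n) - f u) - 'd f u ((tau n)^-1 *: (y n - u))|
      <= e * `|(tau n)^-1 *: (y n - u)|.
Proof.
move=> df yu tau0 e e0; have H := yu _ (diff_remainder df e0).
near=> n; have hn : `|f (y n) - f u - 'd f u (y n - u)| <= e * `|y n - u|.
  by near: n.
have t0 : 0 <= (tau n)^-1 by rewrite invr_ge0 ltW.
by rewrite linearZ -scalerBr !normrZ mulrCA ler_wpM2l.
Unshelve. all: by end_near. Qed.

Lemma quotient_cvg (R : realType) (V W : normedModType R) (f : V -> W)
    u w (y : nat -> V) (tau : nat -> R) :
  differentiable f u -> y n @[n --> \oo] --> u -> (forall n, 0 < tau n) ->
  (tau n)^-1 *: (y n - u) @[n --> \oo] --> w ->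
  (tau n)^-1 *: (f (y n) - f u) @[n --> \oo] --> 'd f u w.
Proof.
move=> df yu tau0 hw; set q := fun n => _ *: (y n - u) in hw.
have -> : (fun n => (tau n)^-1 *: (f (y n) - f u)) = (fun n =>
  ((tau n)^-1 *: (f (y n) - f u) - 'd f u (q n)) + 'd f u (q n)).
  by apply/funext => n; rewrite subrK.
rewrite -[X in _ --> X]add0r; apply: cvgD; last first.
  by apply: (cvg_comp _ _ hw); exact: (diff_continuous df).
apply/cvgr0Pnorm_le => e e0.
(* The quotients [q n] converge to [w], so their norms are eventually at most [|w| + 1]; this
   tolerance then makes the remainder at most [e]. *)
have e1 : 0 < e / (`|w| + 1) by rewrite divr_gt0// ltr_wpDl.
have nq : \forall n \near \oo, `|q n| <= `|w| + 1.
  by apply: (cvgr_norm_le _ hw); rewrite ltrDl.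
apply: filterS2 (quotient_remainder df yu tau0 e1) nq => n h1 h2.
apply: le_trans h1 _; rewrite mulrAC ler_pdivrMr ?ltr_wpDl//.
by rewrite ler_pM2l.
Qed.

(** A converse of [quotient_cvg]: the lower bound on ['d f u] first bounds the quotients of [y] by
    those of [f], so that the remainder vanishes in the limit; the dual family then recovers their
    limit coordinate by coordinate. *)
Lemma quotient_lift (R : realType) (E : normedModType R)
    (ip : {dot E for idfun}) k (f : 'rV[R]_k -> E) u v
    (y : nat -> 'rV[R]_k) (tau : nat -> R) :
  euclidean ip -> differentiable f u -> injective ('d f u : 'rV[R]_k -> E) ->
  y n @[n --> \oo] --> u -> (forall n, 0 < tau n) ->
  (tau n)^-1 *: (f (y n) - f u) @[n --> \oo] --> v ->
  exists2 w, v = 'd f u w & (tau n)^-1 *: (y n - u) @[n --> \oo] --> w.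
Proof.
move=> hE df fi yu tau0 hv.
have [C C0 Cle] := injective_linear_below hE fi.
have [d dA] := injective_linear_dual ip fi.
set q := fun n => _ *: (_ - f u) in hv.
pose h n := (tau n)^-1 *: (y n - u).
have hq : \forall n \near \oo, `|h n| <= C *+ 2 * `|q n|.
  (* With tolerance [1 / (2 C)], the lower bound gives [|h n| <= |h n| / 2 + C |q n|], and half of
     [|h n|] is absorbed on the left. *)
  have e0 : 0 < (C *+ 2)^-1 by rewrite invr_gt0 mulrn_wgt0.
  apply: filterS (quotient_remainder df yu tau0 e0) => n.
  rewrite -/(h n) -/(q n) => hn.
  have := Cle (h n); have := ler_normB (q n - 'd f u (h n)) (q n).
  rewrite addrAC subrr sub0r normrN => h1 h2.
  have h3 : `|'d f u (h n)| <= (C *+ 2)^-1 * `|h n| + `|q n|.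
    by apply: le_trans h1 _; rewrite lerD2r.
  have h4 : `|h n| <= C * ((C *+ 2)^-1 * `|h n| + `|q n|).
    by apply: le_trans h2 _; rewrite ler_pM2l.
  have h5 : C * (C *+ 2)^-1 = 2^-1.
    by rewrite -[C *+ 2]mulr_natl invfM mulrCA divff ?mulr1// gt_eqF.
  move: h4; rewrite mulrDr mulrA h5 mulrnAl; move: (C * _) `|h n| => a b; lra.
have Ah : 'd f u (h n) @[n --> \oo] --> v.
  have -> : (fun n => 'd f u (h n)) = (fun n => q n - (q n - 'd f u (h n))).
    by apply/funext => n; rewrite opprB addrC subrK.
  rewrite -[X in _ --> X]subr0; apply: cvgB => //.
  apply/cvgr0Pnorm_le => e e0.
  have D0 : 0 < C *+ 2 * (`|v| + 1).
    by rewrite mulr_gt0 ?mulrn_wgt0// ltr_wpDl.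
  have nq : \forall n \near \oo, `|q n| <= `|v| + 1.
    by apply: (cvgr_norm_le _ hv); rewrite ltrDl.
  have e1 : 0 < e / (C *+ 2 * (`|v| + 1)) by rewrite divr_gt0.
  apply: filterS3 (quotient_remainder df yu tau0 e1) hq nq => n h1 h2 h3.
  apply: le_trans h1 _; rewrite mulrAC ler_pdivrMr// ler_pM2l//.
  by apply: le_trans h2 _; rewrite ler_pM2l ?mulrn_wgt0.
have hw : h n @[n --> \oo] --> \row_i ip (d i) v.
  apply: cvg_rV => i; rewrite mxE.
  by under eq_fun do rewrite -dA; exact: cvg_dot.
exists (\row_i ip (d i) v) => //.
apply: (cvg_unique _ Ah); first exact: norm_hausdorff.
by apply: (cvg_comp _ _ hw); exact: (diff_continuous df).
Qed.

(** * Sequences that define tangent vectors *)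

(** The definition asks for points of [X] at every index; a shift drops the finitely many bad ones
    and keeps both limits. *)
Lemma tangent_cone_near (R : realType) (E : normedModType R) (X : set E) x v
    (z : nat -> E) (tau : nat -> R) :
  (\forall n \near \oo, X (z n)) -> (forall n, 0 < tau n) ->
  tau n @[n --> \oo] --> (0 : R) ->
  (tau n)^-1 *: (z n - x) @[n --> \oo] --> v -> tangent_cone X x v.
Proof.
move=> [N _ XN] tau0 tauc qv.
exists (fun n => z (n + N)%N), (fun n => tau (n + N)%N); split => [n|//||].
- by apply: XN => /=; rewrite leq_addl.
- by rewrite (cvg_shiftn N).
- by rewrite (cvg_shiftn N (fun n => (tau n)^-1 *: (z n - x))).
Qed.

Lemma tangent_cone_cvg (R : realType) (E : normedModType R) (x v : E)
    (z : nat -> E) (tau : nat -> R) :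
  (forall n, 0 < tau n) -> tau n @[n --> \oo] --> (0 : R) ->
  (tau n)^-1 *: (z n - x) @[n --> \oo] --> v -> z n @[n --> \oo] --> x.
Proof.
move=> tau0 tauc qv.
have -> : z = (fun n => x + tau n *: ((tau n)^-1 *: (z n - x))).
  by apply/funext => n; rewrite scalerA divff ?gt_eqF// scale1r addrC subrK.
rewrite -[X in _ --> X]addr0 -[X in _ --> x + X](scale0r v).
by apply: cvgD; [exact: cvg_cst | exact: cvgZ].
Qed.

(** * Directions tangent to the half-space *)

(* For u in the half-space, its tangent cone at u. *)
Definition feasible (R : realType) k (u w : 'rV[R]_k) :=
  forall i : 'I_k, i.+1 = k -> u ord0 i = 0 -> 0 <= w ord0 i.

Lemma near_last (k : nat) (T : Type) (F : set_system T)
    (P : 'I_k -> T -> Prop) : Filter F ->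
  (forall i : 'I_k, i.+1 = k -> \forall x \near F, P i x) ->
  \forall x \near F, forall i : 'I_k, i.+1 = k -> P i x.
Proof.
move=> FF h; apply: filter_forall => i.
have [ik|ik] := eqVneq i.+1 k; last by apply: nearW => x /eqP; rewrite (negPf ik).
exact: filterS (fun x Px _ => Px) (h i ik).
Qed.

Lemma cvg_coord (R : realType) k (T : Type) (F : set_system T)
    {FF : Filter F} (h : T -> 'rV[R]_k) (w : 'rV[R]_k) i :
  h x @[x --> F] --> w -> h x ord0 i @[x --> F] --> w ord0 i.
Proof.
move=> hw; apply: (@cvg_comp _ _ _ h (fun M : 'rV[R]_k => M ord0 i) _ _ _ hw).
exact: coord_continuous.
Qed.

(** If the last coordinate of [u] is zero, feasibility keeps it nonnegative along the ray; if it is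
    positive, continuity does. *)
Lemma feasible_ray (R : realType) k (u w : 'rV[R]_k) (tau : nat -> R) :
  halfspace u -> feasible u w -> (forall n, 0 < tau n) ->
  tau n @[n --> \oo] --> (0 : R) ->
  \forall n \near \oo, halfspace (u + tau n *: w).
Proof.
move=> Hu fw tau0 tauc; apply: near_last => i ik.
have := Hu i ik; rewrite le_eqVlt => /orP[/eqP u0|u0].
  apply: nearW => n; rewrite !mxE -u0 add0r mulr_ge0 ?(ltW (tau0 n))//.
  exact: fw i ik (esym u0).
have H : (u + tau n *: w) ord0 i @[n --> \oo] --> u ord0 i.
  apply: cvg_coord; rewrite -[X in _ --> X]addr0 -[X in _ --> u + X](scale0r w).
  by apply: cvgD; [exact: cvg_cst | exact: cvgZr_tmp].
exact: (cvgr_ge _ H).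
Qed.

(** Only boundary points constrain [w]. If [u] is one, [w] already satisfies that constraint;
    otherwise the points [y n] are eventually off the boundary. *)
Lemma feasible_near (R : realType) k (u w : 'rV[R]_k) (y : nat -> 'rV[R]_k) :
  halfspace u -> feasible u w -> y n @[n --> \oo] --> u ->
  \forall n \near \oo, feasible (y n) w.
Proof.
move=> Hu fw yu; apply: near_last => i ik.
have := Hu i ik; rewrite le_eqVlt => /orP[/eqP u0|u0].
  by apply: nearW => n _; exact: fw i ik (esym u0).
have H : y n ord0 i @[n --> \oo] --> u ord0 i by exact: cvg_coord.
near=> n => y0; suff : 0 < y n ord0 i by rewrite y0 ltxx.
by near: n; exact: cvgr_gt H _ u0.
Unshelve. all: by end_near. Qed.

Lemma quotient_feasible (R : realType) k (u w : 'rV[R]_k)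
    (y : nat -> 'rV[R]_k) (tau : nat -> R) :
  (\forall n \near \oo, halfspace (y n)) -> (forall n, 0 < tau n) ->
  (tau n)^-1 *: (y n - u) @[n --> \oo] --> w -> feasible u w.
Proof.
move=> Hy tau0 hw i ik u0.
have H : ((tau n)^-1 *: (y n - u)) ord0 i @[n --> \oo] --> w ord0 i.
  exact: cvg_coord.
apply: (cvgr_to_ge H); near=> n; have Hn : halfspace (y n) by near: n.
by rewrite !mxE u0 subr0 mulr_ge0 ?invr_ge0 ?(ltW (tau0 n))//; exact: Hn.
Unshelve. all: by end_near. Qed.

(** * Tangent cones read in a chart *)

Lemma chart_cvg (R : realType) (E : normedModType R) (X : set E) k U
    (O : set 'rV[R]_k) psi phi u (s : nat -> E) :
  boundary_chart X U O psi phi -> O u -> halfspace u ->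
  (\forall n \near \oo, X (s n)) -> s n @[n --> \oo] --> psi u ->
  phi (s n) @[n --> \oo] --> u /\
  \forall n \near \oo, [/\ O (phi (s n)), halfspace (phi (s n)) &
                          psi (phi (s n)) = s n].
Proof.
move=> [[Uo Oo] _ _ im [phiK phic]] Ou Hu Xs sx.
have UXu : (U `&` X) (psi u) by rewrite -im; exists u.
have UXs : \forall n \near \oo, (U `&` X) (s n).
  have Us := sx _ (open_nbhs_nbhs (conj Uo UXu.1)).
  by apply: filterS2 Us Xs => n.
split; last first.
  apply: filterS UXs => n; rewrite -im => -[u' [Ou' Hu'] <-].
  by rewrite phiK.
rewrite -[u in X in _ --> X](phiK u Ou Hu).
(* Since [phi] is continuous only within the intersection of [U] and [X], convergence of [s] is
   transferred to that subspace, where [s] eventually lies. *)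
have h : s n @[n --> \oo] --> (psi u : subspace (U `&` X)).
  apply/subspace_cvgP => // B hB; rewrite /within/= in hB.
  by have := sx _ hB; apply: filterS2 UXs => n UXn; exact.
by apply: (cvg_comp _ _ h); exact: phic.
Qed.

Lemma smooth_differentiable (R : realType) (V W : normedModType R) (O : set V)
    (f : V -> W) u : smooth_on O f -> O u -> differentiable f u.
Proof. by move=> /(_ 1%N)[df _] /df. Qed.

Lemma tangent_cone_chart (R : realType) (E : normedModType R)
    (ip : {dot E for idfun}) (X : set E) k U (O : set 'rV[R]_k) psi phi u v :
  euclidean ip -> boundary_chart X U O psi phi -> O u -> halfspace u ->
  tangent_cone X (psi u) v -> exists2 w, feasible u w & v = 'd psi u w.
Proof.
move=> hE ch Ou Hu [z [tau [Xz tau0 tauc qv]]].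
have [_ sm inj _ _] := ch.
have [yu yP] := chart_cvg ch Ou Hu (nearW _ Xz) (tangent_cone_cvg tau0 tauc qv).
have qv' : (tau n)^-1 *: (psi (phi (z n)) - psi u) @[n --> \oo] --> v.
  apply: cvg_trans qv; apply: near_eq_cvg.
  by apply: filterS yP => n [_ _ ->].
have [w vw hw] := quotient_lift hE (smooth_differentiable sm Ou)
  (inj u Ou Hu) yu tau0 qv'.
exists w => //; apply: quotient_feasible hw => //.
by apply: filterS yP => n [].
Qed.

Lemma chart_tangent_cone (R : realType) (E : normedModType R) (X : set E)
    k U (O : set 'rV[R]_k) psi phi u w :
  boundary_chart X U O psi phi -> O u -> halfspace u -> feasible u w ->
  tangent_cone X (psi u) ('d psi u w).
Proof.
move=> [[_ Oo] sm _ im _] Ou Hu fw.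
(* Any positive null sequence would do: along the ray [y] the difference quotients are constantly
   [w]. *)
pose tau n : R := n.+1%:R^-1; pose y n := u + tau n *: w.
have tau0 n : 0 < tau n by rewrite invr_gt0.
have tauc : tau n @[n --> \oo] --> (0 : R) by exact: cvg_harmonic.
have yu : y n @[n --> \oo] --> u.
  rewrite -[X in _ --> X]addr0 -[X in _ --> u + X](scale0r w).
  by apply: cvgD; [exact: cvg_cst | exact: cvgZr_tmp].
have yO : \forall n \near \oo, O (y n) := yu _ (open_nbhs_nbhs (conj Oo Ou)).
apply: (@tangent_cone_near _ _ _ _ _ (psi \o y) tau) => //.
  apply: filterS2 yO (feasible_ray Hu fw tau0 tauc) => n On Hn.
  suff [] : (U `&` X) (psi (y n)) by [].
  by rewrite -im; exists (y n).
apply: quotient_cvg => //; first exact: smooth_differentiable sm Ou.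
apply: cvg_near_cst; apply: nearW => n.
by rewrite /y addrAC subrr add0r scalerA mulVf ?scale1r// gt_eqF.
Qed.

(** * Local closedness *)

Lemma closed_halfspace (R : realType) k : closed (@halfspace R k).
Proof.
have -> : @halfspace R k =
    \bigcap_(i in [set i : 'I_k | i.+1 = k])
      ((fun u : 'rV[R]_k => u ord0 i) @^-1` [set x : R | 0 <= x]).
  by apply/seteqP; split.
apply: closed_bigI => i _; apply: preimage_closed; last exact: closed_ge.
by move=> u _; exact: coord_continuous.
Qed.

Lemma locally_closed_local (T : topologicalType) (X : set T) :
  (forall x, X x -> exists V K, [/\ open V, V x, closed K &
     V `&` X `<=` K /\ K `<=` X]) -> locally_closed X.
Proof.
move=> h.
(* The largest open set in which [closure X] adds no point to [X]. A point of [closure X] in a given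
   [V] is a limit of points of [X] in [V], hence lies in the closed set [K] and so in [X]. *)
exists (\bigcup_(V in [set V | open V /\ V `&` closure X `<=` X]) V), (closure X).
split; [by apply: bigcup_open => V [] | exact: closed_closure |].
apply/seteqP; split => [x Xx|x [[V [_ VX] Vx] cx]]; last exact: VX.
split; last exact: subset_closure.
have [V [K [Vo Vx cK [VXK KX]]]] := h x Xx; exists V => //; split => // y [Vy cy].
apply: KX; apply: cK => B By.
have [z [Xz [Vz Bz]]] := cy _ (filterI (open_nbhs_nbhs (conj Vo Vy)) By).
by exists z; split => //; apply: VXK.
Qed.

Lemma within_continuous_near (T U : topologicalType) (A : set T) (f : T -> U)
    x (B : set U) : {within A, continuous f} -> A x -> nbhs (f x) B ->
  \forall y \near x, A y -> B (f y).
Proof. by move=> fc Ax /(fc x); rewrite /nbhs/= -nbhs_subspace_in. Qed.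

Lemma embedded_locally_closed (R : realType) (E : normedModType R) (X : set E) :
  embedded_submanifold_with_boundary X -> locally_closed X.
Proof.
move=> [k hX]; apply: locally_closed_local => x Xx.
have [U [ O [psi [phi [Ux [[Uo Oo] sm _ im [phiK phic]]]]]]] := hX x Xx.
have [u [Ou Hu] ux] : (psi @` (O `&` @halfspace R k)) x by rewrite im.
have [r r0 rO] : exists2 r : R, 0 < r & closed_ball u r `<=` O.
  have /nbhs_closedballP[r rO] : nbhs u O by exact: open_nbhs_nbhs.
  by exists r%:num.
pose B := closed_ball u r `&` @halfspace R k.
have cB : compact B.
  apply: compact_closedI; last exact: closed_halfspace.
  apply: bounded_closed_compact; last exact: closed_ball_closed.
  exists (`|u| + r); split => [|M rM y]; first exact: num_real.
  rewrite closed_ballE// => yr; apply: le_trans (ltW rM).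
  by have := ler_normB u (u - y); rewrite subKr => /le_trans; apply; rewrite lerD2l.
have BO : B `<=` O `&` @halfspace R k by move=> y [/rO].
have BX : psi @` B `<=` X.
  by move=> _ [y /BO yO <-]; suff [] : (U `&` X) (psi y) by []; rewrite -im; exists y.
have cpB : closed (psi @` B).
  apply: compact_closed; first exact: norm_hausdorff.
  apply: continuous_compact cB; apply: continuous_in_subspaceT => y.
  rewrite inE => /BO[Oy _]; apply: differentiable_continuous.
  exact: smooth_differentiable sm Oy.
have UXx : (U `&` X) x by [].
have nb : nbhs (phi x) (closed_ball u r).
  rewrite -ux phiK//; apply: filterS (nbhsx_ballx u r r0).
  exact: subset_closed_ball.
pose V := [set y | (U `&` X) y -> closed_ball u r (phi y)].
have Vx : nbhs x V by exact: within_continuous_near phic UXx nb.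
exists (V^° `&` U), (psi @` B); split => //.
  by apply: openI => //; exact: open_interior.
split => // y [[/interior_subset Vy Uy] Xy].
have UXy : (U `&` X) y by [].
have yr := Vy UXy; move: UXy; rewrite -im => -[u' [Ou' Hu'] u'y].
exists u' => //; split => //.
by move: yr; rewrite /= -u'y phiK.
Qed.

(** * Clarke regularity *)

(** Distances are nonnegative, so an upper limit equal to 0 means convergence to 0; this form spares
    later proofs the extended reals. *)
Lemma liminf_setsP (R : realType) (E : normedModType R) (C : nat -> set E) v :
  liminf_sets C v <->
  forall e, 0 < e -> \forall n \near \oo, exists2 y, C n y & `|v - y| < e.
Proof.
split => [h e e0|h].
  have dc : edist_inf (C n) v @[n --> \oo] --> (0 : R)%:E.
    apply: limn_esup_le_cvg => [|n]; last exact: edist_inf_ge0.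
    by rewrite h.
  have H := dc _ (@nbhs_open_ereal_lt R 0 (cst e) e0).
  near=> n; have : (edist_inf (C n) v < e%:E)%E by near: n.
  move=> /ereal_inf_lt[_ [y Cy <-]] /edist_lt_ball /= vy.
  by exists y => //; move: vy; rewrite -ball_normE.
have dle e : 0 < e -> \forall n \near \oo, (edist_inf (C n) v <= e%:E)%E.
  move=> e0; near=> n; have [y Cy vy] : exists2 y, C n y & `|v - y| < e.
    by near: n; exact: h.
  apply: (@le_trans _ _ (edist (v, y))); first by apply: ereal_inf_lbound; exists y.
  by apply: edist_fin => //=; rewrite -ball_normE.
apply: (cvg_limn_einf_sup _).2.
(* A finite bound excludes the value [+oo], taken when [C n] is empty. *)
have dfin n e : (edist_inf (C n) v <= e%:E)%E -> edist_inf (C n) v \is a fin_num.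
  by move=> le; rewrite ge0_fin_numE ?edist_inf_ge0// (le_lt_trans le)// ltry.
apply/fine_cvgP; split.
  by near=> n; apply: (dfin _ 1); near: n; exact: dle.
apply/cvgr0Pnorm_le => e e0; near=> n.
have le : (edist_inf (C n) v <= e%:E)%E by near: n; exact: dle.
rewrite /= ger0_norm ?fine_ge0 ?edist_inf_ge0//.
by rewrite -lee_fin fineK// (dfin _ _ le).
Unshelve. all: by end_near. Qed.

Lemma embedded_clarke_regular (R : realType) (E : normedModType R)
    (ip : {dot E for idfun}) (X : set E) : euclidean ip ->
  embedded_submanifold_with_boundary X -> forall x, X x -> clarke_regular X x.
Proof.
move=> hE hX x Xx; split => //; first exact: embedded_locally_closed.
move=> s Xs sx v; have [k /(_ x Xx)] := hX.
move=> [U [ O [psi [phi [Ux ch]]]]]; have [[Uo Oo] sm _ im _] := ch.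
have [u [Ou Hu] ux] : (psi @` (O `&` @halfspace R k)) x by rewrite im.
rewrite -ux in sx *; move=> /(tangent_cone_chart hE ch Ou Hu)[w fw ->].
have [yu yP] := chart_cvg ch Ou Hu (nearW _ Xs) sx.
(* The direction [w] is fixed and only the base point moves, so the continuity of directional
   derivatives in [Ck_on 1] suffices. *)
have dc : 'd psi (phi (s n)) w @[n --> \oo] --> 'd psi u w.
  apply: (cvg_comp _ _ yu (_ : 'd psi y w @[y --> u] --> _)).
  by have [_ /(_ w)] := sm 1%N; apply.
apply/liminf_setsP => e e0.
have /cvgrPdist_lt/(_ e e0) := dc.
apply: filterS3 yP (feasible_near Hu fw yu) => n [ On Hn psin] fn.
exists ('d psi (phi (s n)) w) => //.
by have := chart_tangent_cone ch On Hn fn; rewrite psin.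
Qed.

(** * Absence of apocalypses at Clarke regular points *)

Lemma tangent_coneZ (R : realType) (E : normedModType R) (X : set E) x v a :
  0 < a -> tangent_cone X x v -> tangent_cone X x (a *: v).
Proof.
move=> a0 [z [tau [Xz tau0 tauc qv]]]; exists z, (fun n => a^-1 * tau n).
split => //.
- by move=> n; rewrite mulr_gt0// invr_gt0.
- by rewrite -[X in _ --> X](mulr0 a^-1); exact: cvgMr.
under eq_fun do rewrite invfM invrK -scalerA.
exact: cvgZl_tmp.
Qed.

(* Optimality of p among its own positive multiples gives [ip w p <= |p|^2];
   comparing p with [e *: q] then gives the bound, even though K need not be
   convex. *)
Lemma proj_cone_le (R : realType) (E : normedModType R)
    (ip : {dot E for idfun}) (K : set E) w p q e :
  euclidean ip -> (forall a v, 0 < a -> K v -> K (a *: v)) ->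
  is_proj K w p -> `|p| <= e -> 0 < e -> K q ->
  ip w q *+ 2 <= e * (1 + `|q| ^+ 2).
Proof.
move=> [nE _] cK [Kp pmin] pe e0 Kq.
have dist2 a v : `|w - a *: v| ^+ 2 =
    `|w| ^+ 2 - a * ip w v *+ 2 + a ^+ 2 * `|v| ^+ 2.
  rewrite !nE dotDD !dotNr dotZr [ip (- _) _]dotC dotNr dotZr.
  by rewrite [ip (_ *: _) _]dotC dotZr; ring.
have le2 a v : 0 < a -> K v -> `|w - p| ^+ 2 <= `|w - a *: v| ^+ 2.
  by move=> a0 Kv; rewrite ler_pXn2r ?nnegrE//; apply/pmin/cK.
have dp := dist2 1 p; rewrite scale1r mul1r expr1n mul1r in dp.
have wp : ip w p <= `|p| ^+ 2.
  set B := `|p| ^+ 2; set A := ip w p; rewrite leNgt; apply/negP => AB.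
  have B0 : 0 <= B by exact: exprn_ge0.
  (* Optimality against [(1 + d) *: p] amounts to [2 * (A - B) <= d * B], whereas this [d] gives
     [d * B < A - B]. *)
  pose d := (A - B) / (B + 1).
  have B1 : 0 < B + 1 by rewrite ltr_wpDl.
  have d0 : 0 < d by rewrite divr_gt0// subr_gt0.
  have dB : d * (B + 1) = A - B by rewrite divfK// gt_eqF.
  have := le2 (1 + d) p (addr_gt0 ltr01 d0) Kp; rewrite dp dist2 -/A -/B => h.
  have : 2 * d * A <= d * ((2 + d) * B) by lra.
  rewrite -mulrA mulrCA ler_pM2l//; nra.
have := le2 e q e0 Kq; rewrite dp dist2 => h.
have pe2 : `|p| ^+ 2 <= e ^+ 2 by rewrite ler_pXn2r ?nnegrE// ltW.
(* After multiplication by [e], the bound follows from [2 * ip w p - |p|^2 <= |p|^2 <= e^2]. *)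
rewrite -(ler_pM2l e0); lra.
Qed.

Lemma gradientP (R : realType) (E : normedModType R) (ip : {dot E for idfun})
    (f : E -> R) x v : euclidean ip -> 'd f x v = ip (gradient ip f x) v.
Proof.
move=> hE; rewrite /gradient; case: xgetP => [g _ -> //|nog].
by have [g gP] := riesz ('d f x) hE; case: (nog g).
Qed.

(** [Ck_on] gives continuity in the base point for each fixed direction. Expanding the direction in
    finitely many vectors [b i] makes it joint, as needed when tangent vectors vary with their base
    points. *)
Lemma diff_cvg_pair (R : realType) (E : normedModType R)
    (ip : {dot E for idfun}) (f : E -> R) (O : set E) (x v : E) :
  euclidean ip -> Ck_on 1 O f -> O x ->
  'd f (z.1) (z.2) @[z --> (x, v)] --> 'd f x v.
Proof.
move=> hE [_ dfc] Ox; have [m [b [d bd]]] := euclidean_coordinates hE.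
have dE z w : 'd f z w = \sum_(i < m) ip (d i) w * 'd f z (b i).
  rewrite {1}(bd w) linear_sum; apply: eq_bigr => i _.
  by rewrite linearZ.
rewrite dE; under eq_fun do rewrite dE.
apply: cvg_big => [|i _]; first exact: add_continuous.
apply: cvgM; first by apply: cvg_dot => //; exact: cvg_snd.
exact: (cvg_comp _ (fun z => 'd f z (b i)) cvg_fst (dfc (b i) x Ox)).
Qed.

Lemma clarke_regular_not_apocalyptic (R : realType) (E : normedModType R)
    (ip : {dot E for idfun}) (X : set E) x :
  euclidean ip -> clarke_regular X x -> ~ apocalyptic ip X x.
Proof.
move=> hE [_ _ cl] [Xx [s [f [ O [eps [[Xs sx] [_ XO fC] [e0 ec] es nst]]]]]].
apply: nst => v /(cl s Xs sx)/liminf_setsP lim.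
rewrite leNgt; apply/negP => L0; set L := 'd f x v in L0.
have dc := @diff_cvg_pair _ _ ip f O x v hE fC (XO x Xx).
(* Below the threshold [L / 2], [- 2 * 'd f (s n) y] exceeds [- L], while the stationarity bound for
   it is eventually less than [- L]. *)
have L2 : L < L / 2 by lra.
have [[A B] /= [Ax Bv] AB] := cvgr_lt _ dc _ L2.
have [r r0 rB] : exists2 r, 0 < r & forall y, `|v - y| < r -> B y.
  have /nbhs_ballP[r r0 rB] := Bv; exists r => // y vy; apply: rB.
  by rewrite -ball_normE.
(* Bounds [1 + |y|^2] for every [y] at distance less than 1 from [v]. *)
pose M := 1 + (`|v| + 1) ^+ 2.
have M0 : 0 < M by rewrite ltr_wpDr// exprn_ge0.
have eM : \forall n \near \oo, eps n * M < - L.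
  have h : eps n * M @[n --> \oo] --> 0 * M by exact: cvgMl.
  by apply: cvgr_lt h _ _; rewrite mul0r oppr_gt0.
have r1 : 0 < Num.min r 1 by rewrite lt_min r0 ltr01.
near \oo => n.
have [y Ky] : exists2 y, tangent_cone X (s n) y & `|v - y| < Num.min r 1.
  by near: n; exact: lim.
rewrite lt_min => /andP[vyr vy1].
have An : A (s n) by near: n; exact: sx.
have : 'd f (s n) y < L / 2 by apply: (AB (s n, y)); split => //; exact: rB.
have [p [pproj pe]] := es n.
have := proj_cone_le hE (fun a w => @tangent_coneZ _ _ X (s n) w a) pproj pe
  (e0 n) Ky.
rewrite [ip (- _) y]dotC dotNr dotC -gradientP// => h1 h2.
have yM : `|y| <= `|v| + 1.
  have := ler_normB v (v - y); rewrite subKr => /le_trans; apply.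
  by rewrite lerD2l ltW.
have h3 : eps n * (1 + `|y| ^+ 2) <= eps n * M.
  by rewrite ler_pM2l// lerD2l ler_pXn2r ?nnegrE ?addr_ge0.
have h4 : eps n * M < - L by near: n.
lra.
Unshelve. all: by end_near. Qed.

Theorem corollary2p16 (R : realType) (E : normedModType R)
    (ip : {dot E for idfun}%R) (hE : euclidean ip)
    (X : set E) (hX : embedded_submanifold_with_boundary X) :
  (forall x : E, X x -> clarke_regular X x) /\
  (forall x : E, X x -> ~ apocalyptic ip X x).
Proof.
have cl := embedded_clarke_regular hE hX; split => // x /cl.
exact: clarke_regular_not_apocalyptic.
Qed.
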